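(* The union of the tropic curves on all quadrics of the confocal family $(\mathcal{Q}_\lambda)$ in the three-dimensional Minkowski space is a union of two ruled surfaces $\Sigma^+$ and $\Sigma^-$ which can be parametrically represented as $$\Sigma^+:\quad x=\frac{a-\lambda}{\sqrt{a+c}}\cos t,\quad y=\frac{b-\lambda}{\sqrt{b+c}}\sin t,\quad z=(c+\lambda)\sqrt{\frac{\cos^2t}{a+c}+\frac{\sin^2t}{b+c}},$$ $$\Sigma^-:\quad x=\frac{a-\lambda}{\sqrt{a+c}}\cos t,\quad y=\frac{b-\lambda}{\sqrt{b+c}}\sin t,\quad z=-(c+\lambda)\sqrt{\frac{\cos^2t}{a+c}+\frac{\sin^2t}{b+c}},$$ with $\lambda\in\mathbf{R}$, $t\in[0,2\pi)$. The intersection of these two surfaces is an ellipse in the $xy$-plane: $$\Sigma^+\cap\Sigma^-:\quad \frac{x^2}{a+c}+\frac{y^2}{b+c}=1,\quad z=0.$$ The two surfaces $\Sigma^+$, $\Sigma^-$ are developable as embedded into Euclidean space. Moreover, their generatrices are all light-like.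
   Context: The three-dimensional Minkowski space $\mathbf{E}^{2,1}$ is $\mathbf{R}^3$ with coordinates $(x,y,z)$ and scalar product $\langle u,w\rangle=u_1w_1+u_2w_2-u_3w_3$. A line with direction vector $v\ne0$ is light-like if $\langle v,v\rangle=0$. Fix constants $a>b>0$, $c>0$. The confocal family of quadrics is $$\mathcal{Q}_\lambda:\ \frac{x^2}{a-\lambda}+\frac{y^2}{b-\lambda}+\frac{z^2}{c+\lambda}=1,\qquad\lambda\in\mathbf{R}.$$ The tropic curves on a quadric $\mathcal{Q}_\lambda$ are the set of its points where the metric induced by $\langle\cdot,\cdot\rangle$ on the tangent plane is degenerate (equivalently, the intersection of $\mathcal{Q}_\lambda$ with the cone $\frac{x^2}{(a-\lambda)^2}+\frac{y^2}{(b-\lambda)^2}-\frac{z^2}{(c+\lambda)^2}=0$). The generatrices of $\Sigma^\pm$ are the straight lines obtained by fixing $t$ and varying $\lambda\in\mathbf{R}$. A surface is developable if its Gaussian curvature (in Euclidean $\mathbf{R}^3$) vanishes.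
   Formalization: For λ = a, b, −c the equation of the quadric divides by zero; there the tropic curve is taken to be the limit (cluster set) of the tropic curves of nearby nondegenerate quadrics, and the union formula is also stated separately with these three values excluded. *)

(* Defs.v *)
From Stdlib Require Import Reals.
From Coquelicot Require Import Coquelicot.
Open Scope R_scope.

Definition vec3 : Type := (R * R * R)%type.

Definition xc (p : vec3) : R := fst (fst p).
Definition yc (p : vec3) : R := snd (fst p).
Definition zc (p : vec3) : R := snd p.

Definition mink (u w : vec3) : R := xc u * xc w + yc u * yc w - zc u * zc w.

Definition dot (u w : vec3) : R := xc u * xc w + yc u * yc w + zc u * zc w.

Definition cross (u w : vec3) : vec3 :=
  (yc u * zc w - zc u * yc w,
   zc u * xc w - xc u * zc w,
   xc u * yc w - yc u * xc w).

Definition line_with_direction (l : vec3 -> Prop) (v : vec3) : Prop :=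
  v <> zero /\
  exists p : vec3, forall q : vec3, l q <-> exists s : R, q = plus p (scal s v).

Definition is_line (l : vec3 -> Prop) : Prop :=
  exists v : vec3, line_with_direction l v.

Definition lightlike_line (l : vec3 -> Prop) : Prop :=
  exists v : vec3, line_with_direction l v /\ mink v v = 0.

Definition quadric_fun (a b c lam : R) (p : vec3) : R :=
  xc p ^ 2 / (a - lam) + yc p ^ 2 / (b - lam) + zc p ^ 2 / (c + lam).

Definition nondegenerate (a b c lam : R) : Prop :=
  lam <> a /\ lam <> b /\ lam <> - c.

Definition quadric (a b c lam : R) (p : vec3) : Prop :=
  quadric_fun a b c lam p = 1.

(* Kernel of the differential of [quadric_fun]; on a nondegenerate quadric this
   differential never vanishes, so the kernel is a plane. *)
Definition tangent_plane (a b c lam : R) (p v : vec3) : Prop :=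
  is_derive (fun s : R => quadric_fun a b c lam (plus p (scal s v))) 0 0.

Definition degenerate_on (P : vec3 -> Prop) : Prop :=
  exists u : vec3, P u /\ u <> zero /\ forall w : vec3, P w -> mink u w = 0.

Definition tropic_point (a b c lam : R) (p : vec3) : Prop :=
  quadric a b c lam p /\ degenerate_on (tangent_plane a b c lam p).

(* For lam = a, b or -c the equation of the quadric divides by zero; the
   quadric is then a (doubly covered) coordinate plane, and its tropic curve is
   read as the limit of the tropic curves of the nearby nondegenerate quadrics.
   Without these three limit curves the union of the tropic curves would miss
   the points of the two surfaces with parameter lam = a, b, -c. *)
Definition tropic_curve (a b c lam : R) (p : vec3) : Prop :=
  (nondegenerate a b c lam /\ tropic_point a b c lam p) \/
  (~ nondegenerate a b c lam /\
   forall eps : posreal, exists (mu : R) (q : vec3),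
     ball lam eps mu /\ ball p eps q /\
     nondegenerate a b c mu /\ tropic_point a b c mu q).

Definition param_surface : Type := R -> R -> vec3.

Definition Sigma_plus (a b c : R) : param_surface := fun lam t =>
  ((a - lam) / sqrt (a + c) * cos t,
   (b - lam) / sqrt (b + c) * sin t,
   (c + lam) * sqrt (cos t ^ 2 / (a + c) + sin t ^ 2 / (b + c))).

Definition Sigma_minus (a b c : R) : param_surface := fun lam t =>
  ((a - lam) / sqrt (a + c) * cos t,
   (b - lam) / sqrt (b + c) * sin t,
   - (c + lam) * sqrt (cos t ^ 2 / (a + c) + sin t ^ 2 / (b + c))).

Definition on_surface (X : param_surface) (p : vec3) : Prop :=
  exists lam t : R, 0 <= t < 2 * PI /\ p = X lam t.

Definition generatrix (X : param_surface) (t : R) (p : vec3) : Prop :=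
  exists lam : R, p = X lam t.

Definition ruled (X : param_surface) : Prop :=
  forall t : R, 0 <= t < 2 * PI -> is_line (generatrix X t).

Definition ex_derive3 (f : R -> vec3) (s : R) : Prop :=
  ex_derive (fun r => xc (f r)) s /\
  ex_derive (fun r => yc (f r)) s /\
  ex_derive (fun r => zc (f r)) s.

Definition Derive3 (f : R -> vec3) (s : R) : vec3 :=
  (Derive (fun r => xc (f r)) s,
   Derive (fun r => yc (f r)) s,
   Derive (fun r => zc (f r)) s).

Definition D1 (X : param_surface) : param_surface :=
  fun u v => Derive3 (fun r => X r v) u.

Definition D2 (X : param_surface) : param_surface :=
  fun u v => Derive3 (fun r => X u r) v.

Definition ex_partials (X : param_surface) : Prop :=
  forall u v : R, ex_derive3 (fun r => X r v) u /\ ex_derive3 (fun r => X u r) v.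

Definition regular_at (X : param_surface) (u v : R) : Prop :=
  cross (D1 X u v) (D2 X u v) <> zero.

Definition unit_normal (X : param_surface) (u v : R) : vec3 :=
  let n := cross (D1 X u v) (D2 X u v) in scal (/ sqrt (dot n n)) n.

(* det II / det I, with Euclidean fundamental forms. *)
Definition gaussian_curvature (X : param_surface) (u v : R) : R :=
  let E := dot (D1 X u v) (D1 X u v) in
  let F := dot (D1 X u v) (D2 X u v) in
  let G := dot (D2 X u v) (D2 X u v) in
  let n := unit_normal X u v in
  let L := dot (D1 (D1 X) u v) n in
  let M := dot (D2 (D1 X) u v) n in
  let N := dot (D2 (D2 X) u v) n in
  (L * N - M ^ 2) / (E * G - F ^ 2).

(* Curvature makes sense only at regular points of the parametrization, and a
   developable surface typically has an edge of regression; density of the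
   regular points excludes parametrizations that collapse to a curve. The
   existence of second partial derivatives rules out default values of
   [Derive]. *)
Definition developable (X : param_surface) : Prop :=
  ex_partials X /\ ex_partials (D1 X) /\ ex_partials (D2 X) /\
  (forall (u v : R) (eps : posreal), exists u' v' : R,
     ball u eps u' /\ ball v eps v' /\ regular_at X u' v') /\
  (forall u v : R, regular_at X u v -> gaussian_curvature X u v = 0).

(* Main.v *)
Require Import Defs.
From Stdlib Require Import Reals Lra Classical FunctionalExtensionality.
From Coquelicot Require Import Coquelicot.
Open Scope R_scope.

(** Let [(l, m, n) = (x / (a - lam), y / (b - lam), z / (c + lam))] be the
    Euclidean normal of the quadric at [(x, y, z)]. The tropic condition says
    that it is light-like, [l^2 + m^2 = n^2], and then the equation
    [(a - lam) l^2 + (b - lam) m^2 + (c + lam) n^2 = 1] of the quadric reads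
    [(a + c) l^2 + (b + c) m^2 = 1], an ellipse parametrized by [t]. For the
    three degenerate values of [lam], the polynomial consequences of this
    description survive the passage to the limit and still determine [t].

    Both surfaces are affine in [lam], with a light-like direction. They meet
    only where [lam = - c], because a point of either is a double root of the
    cubic in [lam] given by the confocal family, and a cubic has at most one.
    Developability holds because the normal is constant along generatrices. *)

(** * Angles on the unit circle and coordinates of vectors *)

Lemma circle_angle (u v : R) : u ^ 2 + v ^ 2 = 1 ->
  exists t : R, 0 <= t < 2 * PI /\ u = cos t /\ v = sin t.
Proof.
  intros H.
  assert (Hu : -1 <= u <= 1) by nra.
  pose proof (acos_bound u) as Hb.
  pose proof PI_RGT_0 as Hpi.
  assert (Hs : sin (acos u) = sqrt (v ^ 2)).
  { rewrite sin_acos by exact Hu. f_equal. unfold Rsqr. lra. }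
  destruct (Rle_lt_dec 0 v) as [Hv | Hv].
  - exists (acos u). rewrite cos_acos, Hs, sqrt_pow2 by assumption. lra.
  - exists (2 * PI - acos u).
    (* As [v < 0], the angle [acos u] is not zero, which keeps [2 * PI - acos u] strictly below
       [2 * PI]. *)
    assert (acos u <> 0).
    { intros H0. rewrite H0, sin_0 in Hs.
      assert (0 < sqrt (v ^ 2)) by (apply sqrt_lt_R0; nra). lra. }
    replace (2 * PI - acos u) with (- acos u + 2 * INR 1 * PI) by (simpl; ring).
    rewrite cos_period, sin_period, cos_neg, sin_neg, cos_acos, Hs by assumption.
    replace (v ^ 2) with ((- v) ^ 2) by ring.
    rewrite sqrt_pow2 by lra. simpl. lra.
Qed.

Lemma cos2_sin2 (t : R) : cos t ^ 2 + sin t ^ 2 = 1.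
Proof. rewrite <- (sin2_cos2 t); unfold Rsqr; ring. Qed.

Lemma vec3_zero : (zero : vec3) = (0, 0, 0).
Proof. reflexivity. Qed.

Lemma vec3_plus_scal (x y z s u v w : R) :
  plus ((x, y, z) : vec3) (scal s ((u, v, w) : vec3)) =
  (x + s * u, y + s * v, z + s * w).
Proof. reflexivity. Qed.

Lemma vec3_neq0 (x y z : R) :
  ((x, y, z) : vec3) <> zero -> x <> 0 \/ y <> 0 \/ z <> 0.
Proof.
  intros H.
  destruct (Req_dec x 0) as [-> |]; [| tauto].
  destruct (Req_dec y 0) as [-> |]; [| tauto].
  destruct (Req_dec z 0) as [-> |]; [| tauto].
  now destruct H.
Qed.

Lemma div_sqr_scaled (X d N : R) : d <> 0 -> X = d * N -> X ^ 2 / d = d * N ^ 2.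
Proof. intros Hd ->. now field. Qed.

(** * Tropic points as points with light-like Euclidean normal *)

(** The derivative along [(u, v, w)] is twice the pairing with the Euclidean normal; uniqueness of
    derivatives turns its vanishing into a linear equation. *)
Lemma tangent_plane_iff (a b c lam x y z u v w : R) :
  nondegenerate a b c lam ->
  (tangent_plane a b c lam (x, y, z) (u, v, w) <->
   x / (a - lam) * u + y / (b - lam) * v + z / (c + lam) * w = 0).
Proof.
  intros (Ha & Hb & Hc).
  assert (HD : is_derive
    (fun s : R => quadric_fun a b c lam
       (plus ((x, y, z) : vec3) (scal s ((u, v, w) : vec3)))) 0
    (2 * (x / (a - lam) * u + y / (b - lam) * v + z / (c + lam) * w))).
  { apply is_derive_ext with (f := fun s =>
      (x + s * u) ^ 2 / (a - lam) + (y + s * v) ^ 2 / (b - lam) +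
      (z + s * w) ^ 2 / (c + lam)); [reflexivity |].
    auto_derive; [repeat split; lra | field; repeat split; lra]. }
  unfold tangent_plane. split; intros H.
  - apply is_derive_unique in H. apply is_derive_unique in HD. lra.
  - rewrite H in HD. replace 0 with (2 * 0) at 2 by ring. exact HD.
Qed.

(* The tangent plane is degenerate iff it contains the Minkowski dual of its
   Euclidean normal, i.e. iff that normal is light-like. *)
Lemma degenerate_plane_iff (P : vec3 -> Prop) (l m n : R) :
  l <> 0 \/ m <> 0 \/ n <> 0 ->
  (forall u v w : R, P (u, v, w) <-> l * u + m * v + n * w = 0) ->
  (degenerate_on P <-> l ^ 2 + m ^ 2 - n ^ 2 = 0).
Proof.
  intros Hn HP. split.
  - intros ([[u v] w] & Hu & Hu0 & Horth).
    apply vec3_neq0 in Hu0. apply HP in Hu.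
    (* The three test vectors are the cross products of the normal with the coordinate axes; they
       span the plane. *)
    assert (H1 : mink (u, v, w) (0, n, - m) = 0) by (apply Horth, HP; ring).
    assert (H2 : mink (u, v, w) (- n, 0, l) = 0) by (apply Horth, HP; ring).
    assert (H3 : mink (u, v, w) (m, - l, 0) = 0) by (apply Horth, HP; ring).
    unfold mink, xc, yc, zc in H1, H2, H3; simpl in H1, H2, H3.
    assert (Eu : u * (l ^ 2 + m ^ 2 - n ^ 2) = 0).
    { apply (f_equal (Rmult l)) in Hu. apply (f_equal (Rmult n)) in H2.
      apply (f_equal (Rmult m)) in H3. lra. }
    assert (Ev : v * (l ^ 2 + m ^ 2 - n ^ 2) = 0).
    { apply (f_equal (Rmult m)) in Hu. apply (f_equal (Rmult n)) in H1.
      apply (f_equal (Rmult l)) in H3. lra. }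
    assert (Ew : w * (l ^ 2 + m ^ 2 - n ^ 2) = 0).
    { apply (f_equal (Rmult n)) in Hu. apply (f_equal (Rmult m)) in H1.
      apply (f_equal (Rmult l)) in H2. lra. }
    destruct Hu0 as [H | [H | H]];
      [apply Rmult_integral in Eu | apply Rmult_integral in Ev
      | apply Rmult_integral in Ew]; tauto.
  - intros HQ. exists (l, m, - n). repeat split.
    + apply HP. lra.
    + rewrite vec3_zero. intros E. injection E. intros. lra.
    + intros [[u v] w] Hw. apply HP in Hw.
      unfold mink, xc, yc, zc; simpl. lra.
Qed.

(** The left side of the quadric equation is the pairing of the normal with the point, so on the
    quadric the normal is nonzero and the criterion for degenerate planes applies. *)
Lemma tropic_point_iff (a b c lam x y z : R) :
  nondegenerate a b c lam ->
  (tropic_point a b c lam (x, y, z) <->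
   x ^ 2 / (a - lam) + y ^ 2 / (b - lam) + z ^ 2 / (c + lam) = 1 /\
   (x / (a - lam)) ^ 2 + (y / (b - lam)) ^ 2 - (z / (c + lam)) ^ 2 = 0).
Proof.
  intros Hnd. unfold tropic_point, quadric, quadric_fun, xc, yc, zc; simpl fst; simpl snd.
  assert (Hdeg :
    x ^ 2 / (a - lam) + y ^ 2 / (b - lam) + z ^ 2 / (c + lam) = 1 ->
    (degenerate_on (tangent_plane a b c lam (x, y, z)) <->
     (x / (a - lam)) ^ 2 + (y / (b - lam)) ^ 2 - (z / (c + lam)) ^ 2 = 0)).
  { intros H1. apply degenerate_plane_iff.
    - destruct Hnd as (Ha & Hb & Hc).
      destruct (Req_dec (x / (a - lam)) 0) as [Ex |]; [| tauto].
      destruct (Req_dec (y / (b - lam)) 0) as [Ey |]; [| tauto].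
      destruct (Req_dec (z / (c + lam)) 0) as [Ez |]; [| tauto].
      exfalso.
      replace (x ^ 2 / (a - lam)) with (x * (x / (a - lam))) in H1 by (field; lra).
      replace (y ^ 2 / (b - lam)) with (y * (y / (b - lam))) in H1 by (field; lra).
      replace (z ^ 2 / (c + lam)) with (z * (z / (c + lam))) in H1 by (field; lra).
      rewrite Ex, Ey, Ez in H1. lra.
    - intros u v w. now apply tangent_plane_iff. }
  tauto.
Qed.

(** * Both surfaces in one signed form *)

Definition height (A B t : R) : R := sqrt (cos t ^ 2 / A + sin t ^ 2 / B).

(** The factor [s], specialized to [1] or [-1], allows one argument to serve both surfaces. *)
Definition Sigma (s a b c : R) : param_surface := fun lam t =>
  ((a - lam) / sqrt (a + c) * cos t,
   (b - lam) / sqrt (b + c) * sin t,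
   s * (c + lam) * height (a + c) (b + c) t).

Lemma Sigma_plus_signed (a b c : R) : Sigma_plus a b c = Sigma 1 a b c.
Proof.
  do 2 (apply functional_extensionality; intro).
  unfold Sigma_plus, Sigma, height. f_equal. ring.
Qed.

Lemma Sigma_minus_signed (a b c : R) : Sigma_minus a b c = Sigma (-1) a b c.
Proof.
  do 2 (apply functional_extensionality; intro).
  unfold Sigma_minus, Sigma, height. f_equal. ring.
Qed.

Lemma weighted_circle_pos (A B t : R) : 0 < A -> 0 < B ->
  0 < cos t ^ 2 / A + sin t ^ 2 / B.
Proof.
  intros HA HB.
  pose proof (cos2_sin2 t) as Ht.
  replace (cos t ^ 2 / A + sin t ^ 2 / B)
    with ((B * cos t ^ 2 + A * sin t ^ 2) / (A * B)) by (field; lra).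
  apply Rdiv_lt_0_compat; [| now apply Rmult_lt_0_compat].
  assert (0 < Rmin A B) by now apply Rmin_glb_lt.
  pose proof (Rmin_l A B). pose proof (Rmin_r A B).
  apply Rlt_le_trans with (Rmin A B * (cos t ^ 2 + sin t ^ 2)); [rewrite Ht; lra |].
  rewrite Rmult_plus_distr_l.
  apply Rplus_le_compat; apply Rmult_le_compat_r; auto using pow2_ge_0.
Qed.

Lemma height_pos (A B t : R) : 0 < A -> 0 < B -> 0 < height A B t.
Proof. intros. now apply sqrt_lt_R0, weighted_circle_pos. Qed.

Lemma height_sqr (A B t : R) : 0 < A -> 0 < B ->
  height A B t ^ 2 = cos t ^ 2 / A + sin t ^ 2 / B.
Proof.
  intros. unfold height. rewrite pow2_sqrt; [reflexivity |].
  now apply Rlt_le, weighted_circle_pos.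
Qed.

(** Squaring removes the square roots and the sign [s], leaving expressions rational in [cos t ^ 2]
    and [sin t ^ 2]. *)
Lemma Sigma_coord_sqr (s a b c lam t x y z : R) :
  s ^ 2 = 1 -> 0 < a + c -> 0 < b + c -> (x, y, z) = Sigma s a b c lam t ->
  x ^ 2 * (a + c) = (a - lam) ^ 2 * cos t ^ 2 /\
  y ^ 2 * (b + c) = (b - lam) ^ 2 * sin t ^ 2 /\
  z ^ 2 = (c + lam) ^ 2 * (cos t ^ 2 / (a + c) + sin t ^ 2 / (b + c)).
Proof.
  intros Hs HA HB E. injection E as -> -> ->.
  pose proof (sqrt_lt_R0 _ HA). pose proof (sqrt_lt_R0 _ HB).
  repeat split.
  - rewrite <- (pow2_sqrt (a + c)) at 2 by lra. field. lra.
  - rewrite <- (pow2_sqrt (b + c)) at 2 by lra. field. lra.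
  - rewrite !Rpow_mult_distr, Hs, height_sqr by assumption. ring.
Qed.

(** [C] and [S] become the cosine and sine of the parameter; [z] is known only up to sign, and this
    sign selects the surface. *)
Lemma on_Sigma_intro (a b c lam x y z C S : R) :
  0 < a + c -> 0 < b + c -> C ^ 2 + S ^ 2 = 1 ->
  x * sqrt (a + c) = (a - lam) * C -> y * sqrt (b + c) = (b - lam) * S ->
  z ^ 2 = (c + lam) ^ 2 * (C ^ 2 / (a + c) + S ^ 2 / (b + c)) ->
  exists t : R, 0 <= t < 2 * PI /\
    ((x, y, z) = Sigma_plus a b c lam t \/ (x, y, z) = Sigma_minus a b c lam t).
Proof.
  intros HA HB HCS Hx Hy Hz.
  pose proof (sqrt_lt_R0 _ HA). pose proof (sqrt_lt_R0 _ HB).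
  destruct (circle_angle C S HCS) as (t & Ht & -> & ->).
  exists t. split; [exact Ht |].
  rewrite Sigma_plus_signed, Sigma_minus_signed. unfold Sigma.
  replace x with ((a - lam) / sqrt (a + c) * cos t)
    by (apply Rmult_eq_reg_r with (sqrt (a + c)); [rewrite Hx; field |]; lra).
  replace y with ((b - lam) / sqrt (b + c) * sin t)
    by (apply Rmult_eq_reg_r with (sqrt (b + c)); [rewrite Hy; field |]; lra).
  rewrite <- height_sqr in Hz by assumption.
  assert (Hf : (z - (c + lam) * height (a + c) (b + c) t) *
               (z + (c + lam) * height (a + c) (b + c) t) = 0) by lra.
  apply Rmult_integral in Hf. destruct Hf as [Hf | Hf]; [left | right]; f_equal; lra.
Qed.

(** * Tropic points of the nondegenerate quadrics *)

Lemma tropic_point_Sigma (a b c lam : R) (p : vec3) :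
  0 < a + c -> 0 < b + c -> nondegenerate a b c lam ->
  (tropic_point a b c lam p <->
   exists t : R, 0 <= t < 2 * PI /\
     (p = Sigma_plus a b c lam t \/ p = Sigma_minus a b c lam t)).
Proof.
  intros HA HB Hnd. destruct p as [[x y] z].
  rewrite tropic_point_iff by exact Hnd.
  destruct Hnd as (Hla & Hlb & Hlc).
  pose proof (sqrt_lt_R0 _ HA) as HsA. pose proof (sqrt_lt_R0 _ HB) as HsB.
  split.
  - intros (HQ & HC).
    set (l := x / (a - lam)) in *. set (m := y / (b - lam)) in *.
    set (n := z / (c + lam)) in *.
    assert (Ex : x = (a - lam) * l) by (unfold l; field; lra).
    assert (Ey : y = (b - lam) * m) by (unfold m; field; lra).
    assert (Ez : z = (c + lam) * n) by (unfold n; field; lra).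
    rewrite (div_sqr_scaled x (a - lam) l), (div_sqr_scaled y (b - lam) m),
      (div_sqr_scaled z (c + lam) n) in HQ by (assumption || lra).
    (* Replacing [n ^ 2] by [l ^ 2 + m ^ 2] in the quadric equation puts [(l, m)] on an ellipse,
       which these factors scale to the unit circle. *)
    apply on_Sigma_intro with (C := l * sqrt (a + c)) (S := m * sqrt (b + c));
      try assumption.
    + rewrite !Rpow_mult_distr, !pow2_sqrt by lra. nra.
    + rewrite Ex. ring.
    + rewrite Ey. ring.
    + rewrite !Rpow_mult_distr, !pow2_sqrt by lra. rewrite Ez.
      replace (l ^ 2 * (a + c) / (a + c) + m ^ 2 * (b + c) / (b + c))
        with (l ^ 2 + m ^ 2) by (field; lra).
      replace (l ^ 2 + m ^ 2) with (n ^ 2) by lra. ring.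
  - intros (t & _ & Hp).
    assert (H : exists s, s ^ 2 = 1 /\ (x, y, z) = Sigma s a b c lam t).
    { destruct Hp as [-> | ->];
        [rewrite Sigma_plus_signed; exists 1 | rewrite Sigma_minus_signed; exists (-1)];
        split; [ring | reflexivity | ring | reflexivity]. }
    destruct H as (s & Hs & E).
    destruct (Sigma_coord_sqr _ _ _ _ _ _ _ _ _ Hs HA HB E) as (Ex & Ey & Ez).
    pose proof (cos2_sin2 t) as Ht.
    assert (Ex' : x ^ 2 = (a - lam) ^ 2 * (cos t ^ 2 / (a + c)))
      by (apply Rmult_eq_reg_r with (a + c); [rewrite Ex; field |]; lra).
    assert (Ey' : y ^ 2 = (b - lam) ^ 2 * (sin t ^ 2 / (b + c)))
      by (apply Rmult_eq_reg_r with (b + c); [rewrite Ey; field |]; lra).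
    (* Only the quotients of the cone equation are unfolded, so that their squares split and expose
       [x ^ 2], [y ^ 2], [z ^ 2]. *)
    unfold Rdiv at 4 5 6. rewrite !Rpow_mult_distr. rewrite Ex', Ey', Ez.
    split.
    + transitivity (cos t ^ 2 + sin t ^ 2); [field; repeat split; lra | exact Ht].
    + field; repeat split; lra.
Qed.

(** * Closed relations that pass to the limit curves *)

(** A limit point has nondegenerate tropic points arbitrarily close to it, with parameters close to
    [lam]; a closed condition on a continuous function of both is inherited. *)
Lemma tropic_curve_closed (a b c lam x y z : R) (F : R -> R -> R -> R -> R)
  (D : R -> Prop) :
  closed D ->
  continuous (fun q : R * vec3 =>
    F (fst q) (fst (fst (snd q))) (snd (fst (snd q))) (snd (snd q))) (lam, (x, y, z)) ->
  (forall mu u v w, nondegenerate a b c mu -> tropic_point a b c mu (u, v, w) ->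
     D (F mu u v w)) ->
  tropic_curve a b c lam (x, y, z) -> D (F lam x y z).
Proof.
  intros HD HF Htrop [[Hnd Hp] | [_ Hlim]]; [now apply Htrop |].
  (* Closedness is used by contradiction: a neighbourhood avoiding [D] pulls back along [F] and
     meets an approximating tropic point. *)
  apply HD. intros Hloc. apply HF in Hloc. destruct Hloc as [eps Heps].
  destruct (Hlim eps) as (mu & [[u v] w] & Hmu & Hq & Hnd & Hpt).
  apply (Heps (mu, (u, v, w))); [now split |]. now apply Htrop.
Qed.

(** Only sums, differences, products and projections are decomposed, hence the relations below write
    squares as products. *)
Ltac continuity_coords :=
  lazymatch goal with
  | |- continuous (fun q => @?f q - @?g q) _ =>
      apply (continuous_minus f g); continuity_coords
  | |- continuous (fun q => @?f q + @?g q) _ =>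
      apply (continuous_plus f g); continuity_coords
  | |- continuous (fun q => @?f q * @?g q) _ =>
      apply (continuous_mult f g); continuity_coords
  | |- continuous (fun q => fst (@?f q)) _ =>
      apply (continuous_comp f fst); [continuity_coords | apply continuous_fst]
  | |- continuous (fun q => snd (@?f q)) _ =>
      apply (continuous_comp f snd); [continuity_coords | apply continuous_snd]
  | |- _ => first [apply continuous_const | apply continuous_id]
  end.

(* Relations obtained by eliminating [t]; each is a closed condition, so it
   passes to the limit curves. For each degenerate value of [lam] some of them
   become vacuous and the remaining ones suffice to recover [t]. *)
Lemma tropic_curve_equations (a b c lam x y z : R) :
  0 < a + c -> 0 < b + c -> tropic_curve a b c lam (x, y, z) ->
  x * x * (a + c) * ((b - lam) * (b - lam)) +
    y * y * (b + c) * ((a - lam) * (a - lam)) -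
    (a - lam) * (a - lam) * ((b - lam) * (b - lam)) = 0 /\
  0 <= (a - lam) * (a - lam) - x * x * (a + c) /\
  0 <= (b - lam) * (b - lam) - y * y * (b + c) /\
  z * z * (b - lam) * (b - lam) * (a + c) -
    (c + lam) * (c + lam) * ((b - lam) * (b - lam) + y * y * (a - b)) = 0 /\
  z * z * (a - lam) * (a - lam) * (b + c) -
    (c + lam) * (c + lam) * ((a - lam) * (a - lam) + x * x * (b - a)) = 0.
Proof.
  intros HA HB Hp.
  (* [C] is [cos t ^ 2]: the squared coordinates are affine in it, and each relation becomes an
     identity or inequality after substitution. *)
  assert (Hsq : forall mu u v w,
    nondegenerate a b c mu -> tropic_point a b c mu (u, v, w) -> exists C,
    0 <= C <= 1 /\
  u * u = (a - mu) * (a - mu) * (C / (a + c)) /\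
  v * v = (b - mu) * (b - mu) * ((1 - C) / (b + c)) /\
  w * w = (c + mu) * (c + mu) * (C / (a + c) + (1 - C) / (b + c))).
  { intros mu u v w Hnd Hq.
    apply tropic_point_Sigma in Hq; [| assumption ..].
    assert (H : exists s t, s ^ 2 = 1 /\ (u, v, w) = Sigma s a b c mu t).
    { destruct Hq as (t & _ & [E | E]);
        [rewrite Sigma_plus_signed in E; exists 1, t
        | rewrite Sigma_minus_signed in E; exists (-1), t]; split; (ring || exact E). }
    destruct H as (s & t & Hs & E).
    destruct (Sigma_coord_sqr _ _ _ _ _ _ _ _ _ Hs HA HB E) as (Eu & Ev & Ew).
    pose proof (cos2_sin2 t) as Ht.
    exists (cos t ^ 2). replace (1 - cos t ^ 2) with (sin t ^ 2) by lra.
    repeat split.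
    - apply pow2_ge_0.
    - pose proof (pow2_ge_0 (sin t)). lra.
    - apply Rmult_eq_reg_r with (a + c); [| lra].
      transitivity (u ^ 2 * (a + c)); [ring | rewrite Eu; field; lra].
    - apply Rmult_eq_reg_r with (b + c); [| lra].
      transitivity (v ^ 2 * (b + c)); [ring | rewrite Ev; field; lra].
    - transitivity (w ^ 2); [ring | rewrite Ew; ring]. }
  repeat split.
  - apply (tropic_curve_closed a b c lam x y z (fun l x y z =>
      x * x * (a + c) * ((b - l) * (b - l)) + y * y * (b + c) * ((a - l) * (a - l)) -
      (a - l) * (a - l) * ((b - l) * (b - l))) (fun r => r = 0));
      [apply closed_eq | continuity_coords | | exact Hp].
    intros mu u v w Hnd Hq.
    destruct (Hsq mu u v w Hnd Hq) as (C & HC & Eu & Ev & Ew).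
    rewrite Eu, Ev. field. lra.
  - apply (tropic_curve_closed a b c lam x y z (fun l x y z =>
      (a - l) * (a - l) - x * x * (a + c)) (fun r => 0 <= r));
      [apply closed_ge | continuity_coords | | exact Hp].
    intros mu u v w Hnd Hq.
    destruct (Hsq mu u v w Hnd Hq) as (C & HC & Eu & Ev & Ew).
    rewrite Eu. replace (_ - _) with ((a - mu) ^ 2 * (1 - C)) by (field; lra).
    apply Rmult_le_pos; [apply pow2_ge_0 | lra].
  - apply (tropic_curve_closed a b c lam x y z (fun l x y z =>
      (b - l) * (b - l) - y * y * (b + c)) (fun r => 0 <= r));
      [apply closed_ge | continuity_coords | | exact Hp].
    intros mu u v w Hnd Hq.
    destruct (Hsq mu u v w Hnd Hq) as (C & HC & Eu & Ev & Ew).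
    rewrite Ev. replace (_ - _) with ((b - mu) ^ 2 * C) by (field; lra).
    apply Rmult_le_pos; [apply pow2_ge_0 | lra].
  - apply (tropic_curve_closed a b c lam x y z (fun l x y z =>
      z * z * (b - l) * (b - l) * (a + c) -
      (c + l) * (c + l) * ((b - l) * (b - l) + y * y * (a - b))) (fun r => r = 0));
      [apply closed_eq | continuity_coords | | exact Hp].
    intros mu u v w Hnd Hq.
    destruct (Hsq mu u v w Hnd Hq) as (C & HC & Eu & Ev & Ew).
    rewrite Ev, Ew. field. lra.
  - apply (tropic_curve_closed a b c lam x y z (fun l x y z =>
      z * z * (a - l) * (a - l) * (b + c) -
      (c + l) * (c + l) * ((a - l) * (a - l) + x * x * (b - a))) (fun r => r = 0));
      [apply closed_eq | continuity_coords | | exact Hp].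
    intros mu u v w Hnd Hq.
    destruct (Hsq mu u v w Hnd Hq) as (C & HC & Eu & Ev & Ew).
    rewrite Eu, Ew. field. lra.
Qed.

(** * Generatrices and their directions *)

(** This is the derivative of [Sigma] in [lam]; it depends on [t] alone and so directs the
    generatrix. *)
Definition ruling (s A B t : R) : vec3 :=
  (- (cos t / sqrt A), - (sin t / sqrt B), s * height A B t).

Lemma Sigma_affine (s a b c lam t mu : R) :
  Sigma s a b c lam t =
  plus (Sigma s a b c mu t) (scal (lam - mu) (ruling s (a + c) (b + c) t)).
Proof.
  unfold Sigma, ruling. rewrite vec3_plus_scal. unfold Rdiv.
  f_equal; [f_equal |]; ring.
Qed.

Lemma generatrix_line (s a b c t : R) :
  s ^ 2 = 1 -> 0 < a + c -> 0 < b + c ->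
  line_with_direction (generatrix (Sigma s a b c) t) (ruling s (a + c) (b + c) t).
Proof.
  intros Hs HA HB. split.
  - rewrite vec3_zero. intros E. injection E as _ _ E.
    pose proof (height_pos (a + c) (b + c) t HA HB). nra.
  - exists (Sigma s a b c 0 t). intros q. split.
    + intros [lam ->]. exists (lam - 0). apply Sigma_affine.
    + intros [r ->]. exists r. rewrite (Sigma_affine s a b c r t 0).
      now rewrite Rminus_0_r.
Qed.

(** The square of [height] is exactly the sum of the squares of the first two components. *)
Lemma ruling_lightlike (s A B t : R) :
  s ^ 2 = 1 -> 0 < A -> 0 < B -> mink (ruling s A B t) (ruling s A B t) = 0.
Proof.
  intros Hs HA HB. unfold mink, ruling, xc, yc, zc; simpl fst; simpl snd.
  transitivity (cos t ^ 2 / sqrt A ^ 2 + sin t ^ 2 / sqrt B ^ 2 -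
                s ^ 2 * height A B t ^ 2).
  - field. split; apply Rgt_not_eq, sqrt_lt_R0; assumption.
  - rewrite !pow2_sqrt, Hs, height_sqr by lra. ring.
Qed.

(** * Intersection of the two surfaces *)

(* At a point of a tropic curve the cubic equation in [mu] for the quadrics of
   the family through that point has the double root [lam]. *)
Lemma Sigma_double_root (s a b c lam t x y z : R) :
  s ^ 2 = 1 -> 0 < a + c -> 0 < b + c -> (x, y, z) = Sigma s a b c lam t ->
  exists nu : R, forall mu : R,
    (a - mu) * (b - mu) * (c + mu) - x ^ 2 * (b - mu) * (c + mu)
    - y ^ 2 * (a - mu) * (c + mu) - z ^ 2 * (a - mu) * (b - mu)
    = (mu - lam) ^ 2 * (mu - nu).
Proof.
  intros Hs HA HB E.
  destruct (Sigma_coord_sqr _ _ _ _ _ _ _ _ _ Hs HA HB E) as (Ex & Ey & Ez).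
  (* The third root comes from Vieta: the monic cubic has root sum
     [a + b - c - x ^ 2 - y ^ 2 + z ^ 2]. *)
  exists (a + b - c - x ^ 2 - y ^ 2 + z ^ 2 - 2 * lam). intros mu.
  assert (Hsin : sin t ^ 2 = 1 - cos t ^ 2) by (rewrite <- (cos2_sin2 t); ring).
  assert (Ex' : x ^ 2 = (a - lam) ^ 2 * (cos t ^ 2 / (a + c)))
    by (apply Rmult_eq_reg_r with (a + c); [rewrite Ex; field |]; lra).
  assert (Ey' : y ^ 2 = (b - lam) ^ 2 * (sin t ^ 2 / (b + c)))
    by (apply Rmult_eq_reg_r with (b + c); [rewrite Ey; field |]; lra).
  rewrite Ex', Ey', Ez, Hsin. field. lra.
Qed.

(** If the double roots differed, each would be the simple root of the other factorization, and a
    third evaluation rules this out. *)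
Lemma double_root_unique (l l' n n' : R) :
  (forall m : R, (m - l) ^ 2 * (m - n) = (m - l') ^ 2 * (m - n')) -> l = l'.
Proof.
  intros H. destruct (Req_dec l l') as [| Hne]; [assumption | exfalso].
  assert (Hn' : n' = l).
  { specialize (H l). replace ((l - l) ^ 2 * (l - n)) with 0 in H by ring.
    symmetry in H. apply Rmult_integral in H. destruct H; [| lra].
    exfalso. apply (pow_nonzero (l - l') 2); lra. }
  assert (Hn : n = l').
  { specialize (H l'). replace ((l' - l') ^ 2 * (l' - n')) with 0 in H by ring.
    apply Rmult_integral in H. destruct H; [| lra].
    exfalso. apply (pow_nonzero (l' - l) 2); lra. }
  (* With [d = l - l'], the two sides at this point are [2 * d ^ 3] and [4 * d ^ 3]. *)
  subst. specialize (H (l + (l - l'))).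
  assert (E : (l - l') ^ 3 = 0) by lra.
  apply (pow_nonzero (l - l') 3) in E; lra.
Qed.

Lemma Sigma_intersection (a b c : R) (p : vec3) : 0 < a + c -> 0 < b + c ->
  (on_surface (Sigma_plus a b c) p /\ on_surface (Sigma_minus a b c) p) <->
  (xc p ^ 2 / (a + c) + yc p ^ 2 / (b + c) = 1 /\ zc p = 0).
Proof.
  intros HA HB. destruct p as [[x y] z].
  unfold xc, yc, zc; simpl fst; simpl snd.
  assert (Hs : (-1) ^ 2 = 1) by ring. assert (Hs1 : 1 ^ 2 = 1) by ring.
  split.
  - intros [(l & t & _ & E) (l' & t' & _ & E')].
    rewrite Sigma_plus_signed in E. rewrite Sigma_minus_signed in E'.
    assert (Hl : l = l').
    { destruct (Sigma_double_root _ _ _ _ _ _ _ _ _ Hs1 HA HB E) as (n & Hn).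
      destruct (Sigma_double_root _ _ _ _ _ _ _ _ _ Hs HA HB E') as (n' & Hn').
      apply double_root_unique with n n'. intros m. now rewrite <- Hn, <- Hn'. }
    destruct (Sigma_coord_sqr _ _ _ _ _ _ _ _ _ Hs1 HA HB E) as (Ex & Ey & _).
    subst l'. injection E as _ _ Ez. injection E' as _ _ Ez'.
    pose proof (height_pos (a + c) (b + c) t HA HB).
    pose proof (height_pos (a + c) (b + c) t' HA HB).
    (* The angles may differ, but [z] is nevertheless a multiple of [c + l] by a positive and by a
       negative number, so [c + l] vanishes. *)
    assert (Hlc : (c + l) * (height (a + c) (b + c) t + height (a + c) (b + c) t') = 0)
      by lra.
    apply Rmult_integral in Hlc. destruct Hlc as [Hlc |]; [| lra].
    rewrite Hlc in Ez. replace l with (- c) in * by lra. split; [| lra].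
    transitivity (cos t ^ 2 + sin t ^ 2); [| apply cos2_sin2].
    f_equal; [apply Rmult_eq_reg_r with ((a + c) ^ 2) |
              apply Rmult_eq_reg_r with ((b + c) ^ 2)];
      try (apply pow_nonzero; lra).
    + transitivity (x ^ 2 * (a + c)); [field; lra | rewrite Ex; ring].
    + transitivity (y ^ 2 * (b + c)); [field; lra | rewrite Ey; ring].
  - intros [HE Hz].
    pose proof (sqrt_lt_R0 _ HA). pose proof (sqrt_lt_R0 _ HB).
    (* At [lam = - c] the height coordinate vanishes, so whichever surface contains the point, the
       other does too. *)
    assert (Hboth : forall t, Sigma_plus a b c (- c) t = Sigma_minus a b c (- c) t).
    { intros t. rewrite Sigma_plus_signed, Sigma_minus_signed. unfold Sigma.
      f_equal. ring. }
    destruct (on_Sigma_intro a b c (- c) x y z (x / sqrt (a + c)) (y / sqrt (b + c)))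
      as (t & Ht & Hp); try assumption.
    + unfold Rdiv. rewrite !Rpow_mult_distr, !pow_inv, !pow2_sqrt by lra. exact HE.
    + replace (a - - c) with (sqrt (a + c) * sqrt (a + c))
        by (rewrite sqrt_def by lra; ring).
      field. lra.
    + replace (b - - c) with (sqrt (b + c) * sqrt (b + c))
        by (rewrite sqrt_def by lra; ring).
      field. lra.
    + rewrite Hz. ring.
    + split; exists (- c), t; (split; [exact Ht |]); destruct Hp as [-> | ->];
        congruence.
Qed.

(** * Partial derivatives and developability *)

Definition height' (A B t : R) : R := cos t * sin t * (/ B - / A) / height A B t.

Lemma is_derive_height (A B t : R) : 0 < A -> 0 < B ->
  is_derive (height A B) t (height' A B t).
Proof.
  intros HA HB. pose proof (height_pos A B t HA HB).
  replace (height' A B t) with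
    (2 * (cos t * sin t * (/ B - / A)) / (2 * height A B t))
    by (unfold height'; field; lra).
  apply (is_derive_sqrt (fun t => cos t ^ 2 / A + sin t ^ 2 / B)).
  - auto_derive; [tauto | field; lra].
  - now apply weighted_circle_pos.
Qed.

Lemma ex_derive_height' (A B t : R) : 0 < A -> 0 < B -> ex_derive (height' A B) t.
Proof.
  intros HA HB. apply ex_derive_div.
  - auto_derive. exact I.
  - eexists. now apply is_derive_height.
  - now apply Rgt_not_eq, height_pos.
Qed.

Definition is_derive3 (f : R -> vec3) (s : R) (v : vec3) : Prop :=
  is_derive (fun r => xc (f r)) s (xc v) /\
  is_derive (fun r => yc (f r)) s (yc v) /\
  is_derive (fun r => zc (f r)) s (zc v).

Lemma is_derive3_unique (f : R -> vec3) (s : R) (v : vec3) :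
  is_derive3 f s v -> Derive3 f s = v.
Proof.
  intros (Hx & Hy & Hz). destruct v as [[x y] z]. unfold Derive3.
  f_equal; [f_equal |]; now apply is_derive_unique.
Qed.

Lemma is_derive3_ex (f : R -> vec3) (s : R) (v : vec3) :
  is_derive3 f s v -> ex_derive3 f s.
Proof. intros (Hx & Hy & Hz). repeat split; eexists; eassumption. Qed.

Definition ruling' (s A B t : R) : vec3 :=
  (sin t / sqrt A, - (cos t / sqrt B), s * height' A B t).

Definition Sigma_t (s a b c lam t : R) : vec3 :=
  (- ((a - lam) / sqrt (a + c) * sin t), (b - lam) / sqrt (b + c) * cos t,
   s * (c + lam) * height' (a + c) (b + c) t).

Section Derivatives.

Variables s a b c : R.
Hypothesis (HA : 0 < a + c) (HB : 0 < b + c).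

Let HsA : sqrt (a + c) <> 0 := Rgt_not_eq _ _ (sqrt_lt_R0 _ HA).
Let HsB : sqrt (b + c) <> 0 := Rgt_not_eq _ _ (sqrt_lt_R0 _ HB).

Lemma is_derive3_Sigma_lam (lam t : R) :
  is_derive3 (fun r => Sigma s a b c r t) lam (ruling s (a + c) (b + c) t).
Proof.
  split; [| split]; unfold Sigma, ruling, xc, yc, zc; simpl;
    (auto_derive; [exact I | field; auto]).
Qed.

Lemma is_derive3_Sigma_t (lam t : R) :
  is_derive3 (fun r => Sigma s a b c lam r) t (Sigma_t s a b c lam t).
Proof.
  split; [| split]; unfold Sigma, Sigma_t, xc, yc, zc; simpl.
  - auto_derive; [exact I | field; auto].
  - auto_derive; [exact I | field; auto].
  - apply (is_derive_scal (height (a + c) (b + c))). now apply is_derive_height.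
Qed.

Lemma is_derive3_ruling (t : R) :
  is_derive3 (ruling s (a + c) (b + c)) t (ruling' s (a + c) (b + c) t).
Proof.
  split; [| split]; unfold ruling, ruling', xc, yc, zc; simpl.
  - auto_derive; [exact I | field; auto].
  - auto_derive; [exact I | field; auto].
  - apply (is_derive_scal (height (a + c) (b + c))). now apply is_derive_height.
Qed.

Lemma D1_Sigma : D1 (Sigma s a b c) = fun _ t => ruling s (a + c) (b + c) t.
Proof.
  do 2 (apply functional_extensionality; intro).
  apply is_derive3_unique, is_derive3_Sigma_lam.
Qed.

Lemma D2_Sigma : D2 (Sigma s a b c) = Sigma_t s a b c.
Proof.
  do 2 (apply functional_extensionality; intro).
  apply is_derive3_unique, is_derive3_Sigma_t.
Qed.

Lemma ex_partials_Sigma : ex_partials (Sigma s a b c).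
Proof.
  intros u v. split; eapply is_derive3_ex;
    [apply is_derive3_Sigma_lam | apply is_derive3_Sigma_t].
Qed.

Lemma ex_partials_D1_Sigma : ex_partials (D1 (Sigma s a b c)).
Proof.
  rewrite D1_Sigma. intros u v. split.
  - repeat split; apply ex_derive_const.
  - eapply is_derive3_ex, is_derive3_ruling.
Qed.

Lemma ex_partials_D2_Sigma : ex_partials (D2 (Sigma s a b c)).
Proof.
  rewrite D2_Sigma. intros u v.
  repeat split; unfold Sigma_t, xc, yc, zc; simpl;
    try (auto_derive; exact I).
  apply (ex_derive_scal (height' (a + c) (b + c))). now apply ex_derive_height'.
Qed.

(* For each [t] the right-hand side vanishes for a single [lam], on the edge of
   regression. *)
Lemma cross_Sigma_zc (lam t : R) :
  zc (cross (ruling s (a + c) (b + c) t) (Sigma_t s a b c lam t)) *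
    (sqrt (a + c) * sqrt (b + c)) =
  lam + c - (a + c) * (b + c) * height (a + c) (b + c) t ^ 2.
Proof.
  unfold cross, ruling, Sigma_t, xc, yc, zc; simpl fst; simpl snd.
  rewrite height_sqr by assumption.
  assert (Hsin : sin t ^ 2 = 1 - cos t ^ 2) by (rewrite <- (cos2_sin2 t); ring).
  transitivity (- ((b - lam) * cos t ^ 2 + (a - lam) * sin t ^ 2));
    [field; auto |].
  rewrite Hsin. field. lra.
Qed.

Lemma Sigma_regular_dense (u v : R) (eps : posreal) : exists u' v' : R,
  ball u eps u' /\ ball v eps v' /\ regular_at (Sigma s a b c) u' v'.
Proof.
  assert (Hreg : forall lam t,
    lam + c - (a + c) * (b + c) * height (a + c) (b + c) t ^ 2 <> 0 ->
    regular_at (Sigma s a b c) lam t).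
  { intros lam t Hne E. apply Hne. rewrite <- cross_Sigma_zc.
    rewrite D1_Sigma, D2_Sigma in E. rewrite E. apply Rmult_0_l. }
  pose proof (cond_pos eps) as Heps.
  destruct (Req_dec (u + c - (a + c) * (b + c) * height (a + c) (b + c) v ^ 2) 0)
    as [E | Hne].
  (* For fixed [t] the normal's third component vanishes for one [lam] only, so any small shift
     along the generatrix reaches a regular point. *)
  - exists (u + eps / 2), v. repeat split.
    + change (Rabs (u + eps / 2 - u) < eps). rewrite Rabs_right; lra.
    + apply ball_center.
    + apply Hreg. lra.
  - exists u, v. repeat split; [apply ball_center .. | now apply Hreg].
Qed.

(* The tangent plane is constant along each generatrix. *)
Lemma ruling'_tangent (lam t : R) :
  dot (ruling' s (a + c) (b + c) t)
      (cross (ruling s (a + c) (b + c) t) (Sigma_t s a b c lam t)) = 0.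
Proof.
  pose proof (height_pos (a + c) (b + c) t HA HB) as Hh.
  (* The triple product is free of [lam], since [lam] enters [Sigma_t] only through a multiple of
     [ruling']. *)
  transitivity (s / (sqrt (a + c) * sqrt (b + c)) *
    (height (a + c) (b + c) t * (a - b) * (sin t * cos t)
     - height' (a + c) (b + c) t *
       ((b + c) * cos t ^ 2 + (a + c) * sin t ^ 2))).
  { unfold dot, cross, ruling, ruling', Sigma_t, xc, yc, zc; simpl fst; simpl snd.
    field; auto. }
  assert (Hsqr := height_sqr (a + c) (b + c) t HA HB).
  (* This weighted sum is a multiple of [height ^ 2], which cancels the denominator in [height']. *)
  replace ((b + c) * cos t ^ 2 + (a + c) * sin t ^ 2) with
    ((a + c) * (b + c) * height (a + c) (b + c) t ^ 2) by (rewrite Hsqr; field; lra).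
  unfold height'. field. repeat split; auto; lra.
Qed.

(** In the second fundamental form [L = 0] because the surface is affine in [lam], and [M = 0]
    because [ruling'] is tangent; hence [L * N - M ^ 2 = 0]. *)
Lemma Sigma_developable : developable (Sigma s a b c).
Proof.
  split; [exact ex_partials_Sigma |].
  split; [exact ex_partials_D1_Sigma |].
  split; [exact ex_partials_D2_Sigma |].
  split.
  - exact Sigma_regular_dense.
  - intros u v _. unfold gaussian_curvature, unit_normal.
    rewrite D1_Sigma, D2_Sigma.
    replace (D1 (fun _ t => ruling s (a + c) (b + c) t) u v) with (zero : vec3)
      by (unfold D1, Derive3; now rewrite !Derive_const).
    replace (D2 (fun _ t => ruling s (a + c) (b + c) t) u v)
      with (ruling' s (a + c) (b + c) v)
      by (symmetry; apply is_derive3_unique, is_derive3_ruling).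
    assert (Hdot : forall x k y, dot x (scal k y) = k * dot x y).
    { intros [[x1 x2] x3] k [[y1 y2] y3]. unfold dot, xc, yc, zc; simpl.
      unfold scal; simpl; unfold mult; simpl. ring. }
    rewrite !Hdot, ruling'_tangent.
    replace (dot zero _) with 0 by (unfold dot, xc, yc, zc; simpl; unfold zero; simpl; ring).
    unfold Rdiv. ring.
Qed.

End Derivatives.

(** * The tropic curves of all quadrics, degenerate ones included *)

(** For degenerate [lam] the point is approached along its own generatrix, by parameters [mu] near
    [lam] that avoid [a], [b] and [- c]. *)
Lemma Sigma_tropic (s a b c lam t : R) :
  s = 1 \/ s = -1 -> 0 < a + c -> 0 < b + c -> 0 <= t < 2 * PI ->
  tropic_curve a b c lam (Sigma s a b c lam t).
Proof.
  intros Hs HA HB Ht.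
  assert (Hpt : forall mu, nondegenerate a b c mu ->
                tropic_point a b c mu (Sigma s a b c mu t)).
  { intros mu Hnd. apply tropic_point_Sigma; try assumption.
    exists t. split; [exact Ht |].
    rewrite Sigma_plus_signed, Sigma_minus_signed.
    destruct Hs as [-> | ->]; [now left | now right]. }
  destruct (classic (nondegenerate a b c lam)) as [Hnd | Hnd];
    [left; auto | right; split; [exact Hnd |]].
  intros eps.
  assert (Hne : forall r, locally' lam (fun mu => mu <> r)).
  { intros r. destruct (Req_dec lam r) as [-> | Hlr].
    - exists eps. now intros.
    - apply filter_le_within. now apply open_neq. }
  assert (Hcont : locally lam (fun mu => ball (Sigma s a b c lam t) eps (Sigma s a b c mu t))).
  { assert (Hc : forall f : R -> R, ex_derive f lam ->
             locally lam (fun mu => ball (f lam) eps (f mu))).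
    { intros f Hf. apply (ex_derive_continuous f lam Hf). apply locally_ball. }
    pose proof (is_derive3_ex _ _ _ (is_derive3_Sigma_lam s a b c HA HB lam t))
      as (Hx & Hy & Hz).
    apply Hc in Hx. apply Hc in Hy. apply Hc in Hz.
    generalize (filter_and _ _ (filter_and _ _ Hx Hy) Hz). apply filter_imp.
    intros mu H. exact H. }
  pose proof (Rbar_locally'_filter (Finite lam) : ProperFilter (locally' lam)).
  destruct (filter_ex (F := locally' lam) _
    (filter_and _ _ (filter_and _ _ (Hne a) (filter_and _ _ (Hne b) (Hne (- c))))
      (filter_le_within _ _ (filter_and _ _ (locally_ball lam eps) Hcont))))
    as (mu & Hnd' & Hball & HballS).
  exists mu, (Sigma s a b c mu t).
  split; [exact Hball |]. split; [exact HballS |]. split; [exact Hnd' | now apply Hpt].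
Qed.

Lemma tropic_curve_nondegenerate (a b c lam : R) (p : vec3) :
  nondegenerate a b c lam ->
  (tropic_curve a b c lam p <-> tropic_point a b c lam p).
Proof. intros Hnd. unfold tropic_curve. tauto. Qed.

Lemma tropic_curve_Sigma (a b c lam : R) (p : vec3) :
  b <> a -> 0 < a + c -> 0 < b + c ->
  (tropic_curve a b c lam p <->
   exists t : R, 0 <= t < 2 * PI /\
     (p = Sigma_plus a b c lam t \/ p = Sigma_minus a b c lam t)).
Proof.
  intros Hba HA HB. split.
  2: { intros (t & Ht & [-> | ->]);
         [rewrite Sigma_plus_signed | rewrite Sigma_minus_signed];
         apply Sigma_tropic; auto. }
  intros Hp.
  destruct (classic (nondegenerate a b c lam)) as [Hnd | Hdeg].
  { apply tropic_point_Sigma; try assumption.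
    now apply tropic_curve_nondegenerate. }
  destruct p as [[x y] z].
  destruct (tropic_curve_equations a b c lam x y z HA HB Hp)
    as (Hxy & Hx & Hy & Hz & Hz').
  pose proof (sqrt_lt_R0 _ HA) as HsA. pose proof (sqrt_lt_R0 _ HB) as HsB.
  destruct (Req_dec lam a) as [-> | Hla]; [| destruct (Req_dec lam b) as [-> | Hlb]].
  - assert (Hd : 0 < (b - a) * (b - a)) by nra.
    (* At [lam = a] the relations force [x = 0] and [y] determines the sine; either sign of the
       cosine would do, and the nonnegative root is taken. *)
    set (S2 := y * y * (b + c) / ((b - a) * (b - a))).
    assert (HS2 : S2 <= 1).
    { apply Rmult_le_reg_r with ((b - a) * (b - a)); [assumption |].
      unfold S2, Rdiv. rewrite Rmult_assoc, Rinv_l; lra. }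
    assert (ES : (y / (b - a) * sqrt (b + c)) ^ 2 = S2).
    { rewrite Rpow_mult_distr, pow2_sqrt by lra. unfold S2. field. lra. }
    assert (EC : sqrt (1 - S2) ^ 2 = 1 - S2) by (apply pow2_sqrt; lra).
    apply on_Sigma_intro with (C := sqrt (1 - S2)) (S := y / (b - a) * sqrt (b + c));
      try assumption; rewrite ?EC, ?ES.
    + ring.
    + assert (Ex : x * x * ((a + c) * ((b - a) * (b - a))) = 0) by lra.
      apply Rmult_integral in Ex. destruct Ex as [Ex | Ex]; [| nra].
      apply Rmult_integral in Ex. destruct Ex as [-> | ->]; ring.
    + field. lra.
    + apply Rmult_eq_reg_r with ((b - a) * (b - a) * (a + c)); [| nra].
      transitivity ((c + a) * (c + a) * ((b - a) * (b - a) + y * y * (a - b)));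
        [lra |].
      unfold S2. field. lra.
  - assert (Hd : 0 < (a - b) * (a - b)) by nra.
    (* At [lam = b] the roles are exchanged: [y = 0], and [x] determines the cosine. *)
    set (C2 := x * x * (a + c) / ((a - b) * (a - b))).
    assert (HC2 : C2 <= 1).
    { apply Rmult_le_reg_r with ((a - b) * (a - b)); [assumption |].
      unfold C2, Rdiv. rewrite Rmult_assoc, Rinv_l; lra. }
    assert (EC : (x / (a - b) * sqrt (a + c)) ^ 2 = C2).
    { rewrite Rpow_mult_distr, pow2_sqrt by lra. unfold C2. field. lra. }
    assert (ES : sqrt (1 - C2) ^ 2 = 1 - C2) by (apply pow2_sqrt; lra).
    apply on_Sigma_intro with (C := x / (a - b) * sqrt (a + c)) (S := sqrt (1 - C2));
      try assumption; rewrite ?EC, ?ES.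
    + ring.
    + field. lra.
    + assert (Ey : y * y * ((b + c) * ((a - b) * (a - b))) = 0) by lra.
      apply Rmult_integral in Ey. destruct Ey as [Ey | Ey]; [| nra].
      apply Rmult_integral in Ey. destruct Ey as [-> | ->]; ring.
    + apply Rmult_eq_reg_r with ((a - b) * (a - b) * (b + c)); [| nra].
      transitivity ((c + b) * (c + b) * ((a - b) * (a - b) + x * x * (b - a)));
        [lra |].
      unfold C2. field. lra.
  - assert (Hlc : lam = - c).
    { destruct (Req_dec lam (- c)); [assumption |]. now destruct Hdeg. }
    subst lam.
    (* At [lam = - c] the coordinates [x] and [y] fix cosine and sine, and the relation for [z]
       forces [z = 0]. *)
    apply on_Sigma_intro with (C := x / sqrt (a + c)) (S := y / sqrt (b + c));
      try assumption; unfold Rdiv; rewrite ?Rpow_mult_distr, ?pow_inv, ?pow2_sqrt by lra.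
    + apply Rmult_eq_reg_r with ((a + c) ^ 2 * (b + c) ^ 2);
        [| apply Rmult_integral_contrapositive_currified; apply pow_nonzero; lra].
      transitivity (x * x * (a + c) * ((b - - c) * (b - - c)) +
                    y * y * (b + c) * ((a - - c) * (a - - c))); [field; lra | lra].
    + replace (a - - c) with (sqrt (a + c) * sqrt (a + c))
        by (rewrite sqrt_def by lra; ring).
      field. lra.
    + replace (b - - c) with (sqrt (b + c) * sqrt (b + c))
        by (rewrite sqrt_def by lra; ring).
      field. lra.
    + assert (Ez : z * z * ((b - - c) * (b - - c) * (a + c)) = 0) by lra.
      assert (0 < (b - - c) * (b - - c) * (a + c))
        by (repeat apply Rmult_lt_0_compat; lra).
      apply Rmult_integral in Ez. destruct Ez as [Ez | Ez]; [| lra].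
      transitivity (z * z); [ring | rewrite Ez; ring].
Qed.

(** * Assembly of all the assertions *)

Theorem proposition4p3 (a b c : R) (hb : 0 < b) (hab : b < a) (hc : 0 < c) :
  (forall p : vec3,
     (exists lam : R, nondegenerate a b c lam /\ tropic_curve a b c lam p) <->
     (exists lam t : R, nondegenerate a b c lam /\ 0 <= t < 2 * PI /\
        (p = Sigma_plus a b c lam t \/ p = Sigma_minus a b c lam t))) /\
  (forall p : vec3,
     (exists lam : R, tropic_curve a b c lam p) <->
     (on_surface (Sigma_plus a b c) p \/ on_surface (Sigma_minus a b c) p)) /\
  ruled (Sigma_plus a b c) /\
  ruled (Sigma_minus a b c) /\
  (forall p : vec3,
     (on_surface (Sigma_plus a b c) p /\ on_surface (Sigma_minus a b c) p) <->
     (xc p ^ 2 / (a + c) + yc p ^ 2 / (b + c) = 1 /\ zc p = 0)) /\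
  developable (Sigma_plus a b c) /\
  developable (Sigma_minus a b c) /\
  (forall t : R, 0 <= t < 2 * PI ->
     lightlike_line (generatrix (Sigma_plus a b c) t) /\
     lightlike_line (generatrix (Sigma_minus a b c) t)).
Proof.
  assert (HA : 0 < a + c) by lra. assert (HB : 0 < b + c) by lra.
  assert (Htrop := fun lam p =>
    tropic_curve_Sigma a b c lam p (Rlt_not_eq _ _ hab) HA HB).
  assert (Hline : forall s t, s ^ 2 = 1 ->
    line_with_direction (generatrix (Sigma s a b c) t) (ruling s (a + c) (b + c) t) /\
    mink (ruling s (a + c) (b + c) t) (ruling s (a + c) (b + c) t) = 0).
  { intros s t Hs. split; [now apply generatrix_line | now apply ruling_lightlike]. }
  assert (H1 : 1 ^ 2 = 1) by ring. assert (H2 : (-1) ^ 2 = 1) by ring.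
  split; [| split; [| split; [| split; [| split; [| split; [| split]]]]]].
  - intros p. split.
    + intros (lam & Hnd & Hp). apply Htrop in Hp. destruct Hp as (t & Ht).
      now exists lam, t.
    + intros (lam & t & Hnd & Ht). exists lam. split; [exact Hnd |].
      apply Htrop. now exists t.
  - intros p. split.
    + intros (lam & Hp). apply Htrop in Hp.
      destruct Hp as (t & Ht & [Hp | Hp]); [left | right]; now exists lam, t.
    + intros [(lam & t & Ht & Hp) | (lam & t & Ht & Hp)]; exists lam;
        apply Htrop; exists t; tauto.
  - rewrite Sigma_plus_signed. intros t _. eexists. now apply Hline.
  - rewrite Sigma_minus_signed. intros t _. eexists. now apply Hline.
  - intros p. now apply Sigma_intersection.
  - rewrite Sigma_plus_signed. now apply Sigma_developable.
  - rewrite Sigma_minus_signed. now apply Sigma_developable.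
  - rewrite Sigma_plus_signed, Sigma_minus_signed. intros t _.
    split; eexists; now apply Hline.
Qed.
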